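(* Let $\mathbb{A}_{\Phi}(s)$, $s>0$, denote the integral operator on $L^2(\mathbb{O})$ with kernel $$\mathbb{A}_{\Phi}(s)(\mathbf x,\mathbf y)=\sqrt{1-\Big(1+\frac{s\theta P_A}{m|\mathbf x|^{\mu}}\Big)^{-m}}\;G_{\Phi}(\mathbf x,\mathbf y)\;\sqrt{1-\Big(1+\frac{s\theta P_A}{m|\mathbf y|^{\mu}}\Big)^{-m}} .$$ Then the Laplace transform of $P_I$ is $\mathcal{L}_{P_I}(s)=\mathbb{E}[e^{-sP_I}]=\mathrm{Det}\big(\mathrm{Id}+\alpha\mathbb{A}_{\Phi}(s)\big)^{-1/\alpha}$, the CDF of $P_I$ is $$F_{P_I}(\rho)=\mathcal{L}^{-1}\Big\{\frac{\mathrm{Det}(\mathrm{Id}+\alpha\mathbb{A}_{\Phi}(s))^{-1/\alpha}}{s}\Big\}(\rho),$$ and the energy outage probability of the hybrid transmitter under the power threshold-based protocol (PTP) is $$\mathcal{O}_{\mathrm{PTP}}=F_{P_I}\Big(\frac{\rho_H}{\omega\beta}\Big)\left(F_{P_I}\Big(\frac{\rho_B}{\beta\varrho}\Big)-F_{P_I}\Big(\frac{\rho_H}{\omega\beta}\Big)+1\right).$$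
   Context: Standing model. Parameters: path-loss exponent $\mu>2$; window radius $R>0$; repulsion parameter $\alpha=-1/\kappa$ for a positive integer $\kappa$; densities $\zeta_A,\zeta_B>0$; transmission loads $l_A,l_B\in(0,1]$; ambient transmit powers $P_A,P_B>0$; Nakagami parameters $m>0,\theta>0$; Rayleigh rate $\lambda>0$; RF-to-DC efficiency $\beta\in(0,1]$; backscattering efficiency $\delta\in(0,1]$; harvested fraction $\varrho\in(0,1)$; harvesting time fraction $\omega\in(0,1)$; circuit powers $\rho_B,\rho_H>0$; SNR/SINR thresholds $\tau_B,\tau_H>0$; noise variance $\sigma^2>0$; bandwidth $W>0$; backscatter rate $T_B>0$; transmitter–receiver distance $d>0$. Points of $\mathbb{R}^2$ are identified with complex numbers; $\bar{\mathbf y}$ is the complex conjugate and $|\mathbf x|$ the modulus. $\mathbb{O}=\{\mathbf x:|\mathbf x|\le R\}$. Ginibre kernel with parameter $\zeta>0$: $G(\mathbf x,\mathbf y)=\zeta\, e^{\pi\zeta\mathbf x\bar{\mathbf y}}e^{-\frac{\pi\zeta}{2}(|\mathbf x|^2+|\mathbf y|^2)}$. An $\alpha$-Ginibre point process ($\alpha$-GPP) on $\mathbb{O}$ with kernel $G$ is a finite point process $\Omega$ on $\mathbb{O}$ whose Laplace functional satisfies, for every measurable $\varphi\ge0$, $\mathbb{E}[\exp(-\sum_{\mathbf x\in\Omega}\varphi(\mathbf x))]=\mathrm{Det}(\mathrm{Id}+\alpha\mathbb{K}_\varphi)^{-1/\alpha}$, where $\mathrm{Det}$ is the Fredholm determinant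 and $\mathbb{K}_\varphi$ is the integral operator on $L^2(\mathbb{O})$ with kernel $\sqrt{1-e^{-\varphi(\mathbf x)}}\,G(\mathbf x,\mathbf y)\sqrt{1-e^{-\varphi(\mathbf y)}}$. For a kernel $\mathbb{K}(\mathbf x,\mathbf y)$ on $\mathbb{O}$, $\mathrm{Det}(\mathrm{Id}+\alpha\mathbb{K})$ denotes the Fredholm determinant of the associated integral operator. Network: a hybrid transmitter S and receiver D at distance $d$. The set $\mathcal{A}$ of active ambient transmitters around S, with positions $\mathbf x_a$ measured relative to S, is an $\alpha$-GPP on $\mathbb{O}$ with Ginibre kernel $G_\Phi$ of parameter $l_A\zeta_A$. The set $\mathcal{B}$ of active interfering transmitters around D, with positions $\mathbf x_b$ measured relative to D, is an $\alpha$-GPP on $\mathbb{O}$ with Ginibre kernel $G_\Psi$ of parameter $l_B\zeta_B$. Fading: $h_{a,S}$ ($a\in\mathcal A$) i.i.d. Gamma with shape $m$ and scale $\theta/m$; $\tilde h_{b,D}$ ($b\in\mathcal B$) i.i.d. Gamma with shape $m$ and scale $\theta/m$; $h_{S,D}$ and $\tilde h_{S,D}$ exponential with rate $\lambda$. $\mathcal A,\mathcal B$ and all fading variables are mutually independent. Quantities: incident power $P_I=P_A\sum_{a\in\mathcal A}h_{a,S}|\mathbf x_a|^{-\mu}$; harvesting rates $P_E^B=\beta\varrho P_I$ (backscatter mode) and $P_E^H=\omega\beta P_I$ (harvest-then-transmit, HTT, mode); backscatter SNR $\nu_B=\delta P_I(1-\varrho)h_{S,D}/(d^\mu\sigma^2)$;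 HTT transmit power $P_S=(P_E^H-\rho_H)/(1-\omega)$ if $P_E^H>\rho_H$ and $P_S=0$ otherwise; HTT SINR $\nu_H=P_S\tilde h_{S,D}d^{-\mu}/\big(\sum_{b\in\mathcal B}P_B\tilde h_{b,D}|\mathbf x_b|^{-\mu}+\sigma^2\big)$. $F_{P_I},f_{P_I}$ denote the CDF and PDF of $P_I$ (assumed to exist); $\mathcal{L}^{-1}$ is the inverse Laplace transform. Metrics: for a mode-selection protocol with backscatter-mode probability $\mathcal B$, the energy outage probability is $\mathcal O=\mathcal B\,\mathbb P[P_E^B\le\rho_B]+(1-\mathcal B)\mathbb P[P_E^H\le\rho_H]$; the coverage probability is $\mathcal C=\mathcal B\,\mathbb P[\nu_B>\tau_B,P_E^B>\rho_B]+(1-\mathcal B)\mathbb P[\nu_H>\tau_H,P_E^H>\rho_H]$; the average throughput is $\mathcal T=\mathcal B\,T_B\,\mathbb P[\nu_B>\tau_B,P_E^B>\rho_B]+(1-\mathcal B)\,\mathbb E\big[(1-\omega)W\log_2(1+\nu_H)\mathbb 1\{\nu_H>\tau_H,P_E^H>\rho_H\}\big]$. Power threshold-based protocol (PTP): $\mathcal B=\mathcal B_{\mathrm{PTP}}=\mathbb P[P_E^H\le\rho_H]$. SNR threshold-based protocol (STP): $\mathcal B=\mathcal B_{\mathrm{STP}}=\mathbb P[\nu_B>\tau_B,P_E^B>\rho_B]$. $\mathcal O_{\mathrm{PTP}},\mathcal C_{\mathrm{PTP}},\mathcal T_{\mathrm{PTP}}$ (resp. with STP) denote the metrics under the respective protocol.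 *)

(* Defs.v *)
(* mathcomp-analysis (measure theory, Lebesgue integration,
   probability) + real_closed's complex numbers R[i]. *)
From HB Require Import structures.
From mathcomp Require Import all_boot all_order all_algebra.
From mathcomp Require Import all_classical all_reals all_analysis.
From mathcomp Require Import complex.
Set Implicit Arguments. Unset Strict Implicit. Unset Printing Implicit Defensive.
Import Order.TTheory GRing.Theory Num.Theory.
Import numFieldNormedType.Exports.
Local Open Scope classical_set_scope.
Local Open Scope ring_scope.

Section Defs.
Variable R : realType.
Local Open Scope complex_scope.

(** Points of R^2 are pairs of reals; [cplx] identifies them with complex numbers. *)
Definition cplx (p : R * R) : R[i] := p.1 +i* p.2.

(** Euclidean norm |x| of a point of R^2. *)
Definition pnorm (p : R * R) : R := Num.sqrt (p.1 ^+ 2 + p.2 ^+ 2).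

(** The disc O = {x : |x| <= Rad}. *)
Definition disk (Rad : R) : set (R * R) := [set p | pnorm p <= Rad].

(** Complex exponential e^z = e^{Re z} (cos (complex.Im z) + i sin (complex.Im z)). *)
Definition cexp (z : R[i]) : R[i] :=
  (expR (complex.Re z) * cos (complex.Im z)) +i* (expR (complex.Re z) * sin (complex.Im z)).

(** Ginibre kernel with parameter zeta:
    G(x,y) = zeta e^{pi zeta x conj(y)} e^{-(pi zeta/2)(|x|^2+|y|^2)}. *)
Definition ginibre (zeta : R) (x y : R * R) : R[i] :=
  zeta%:C * cexp ((pi * zeta)%:C * cplx x * (cplx y)^*)
  * (expR (- (pi * zeta / 2) * (pnorm x ^+ 2 + pnorm y ^+ 2)))%:C.

(** Lebesgue measure on R^2. *)
Definition leb2 : set (R * R) -> \bar R :=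
  ((@lebesgue_measure R) \x (@lebesgue_measure R))%E.

(** n-fold integral over O^n of a function of n points (the points are
    passed as a list x_1 :: ... :: x_n). *)
Fixpoint iint (Rad : R) (n : nat) (f : seq (R * R) -> R) : R :=
  match n with
  | 0 => f [::]
  | n'.+1 => Rintegral leb2 (disk Rad) (fun x => iint Rad n' (fun xs => f (x :: xs)))
  end.

(** The n x n matrix [K(x_i, x_j)]_{i,j}. *)
Definition kmat (K : R * R -> R * R -> R[i]) (n : nat) (xs : seq (R * R))
  : 'M[R[i]]_n := \matrix_(i < n, j < n) K (nth (0, 0) xs i) (nth (0, 0) xs j).

(** Fredholm determinant Det(Id + a K) of the integral operator on L^2(O)
    with kernel K, via the Fredholm series
      Det(Id + a K) = sum_{n>=0} a^n/n! \int_{O^n} det[K(x_i,x_j)] dx_1..dx_n.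
    All kernels to which it is applied here are Hermitian, so the
    determinants det[K(x_i,x_j)] are real; we integrate their real part. *)
Definition fredholm_det (Rad : R) (a : R) (K : R * R -> R * R -> R[i]) : R :=
  limn (fun N => \sum_(0 <= n < N)
         (a ^+ n / (n`!)%:R * iint Rad n (fun xs => complex.Re (\det (kmat K n xs))))).

(** Repulsion parameter alpha = -1/kappa. *)
Definition alpha (kappa : nat) : R := - (kappa%:R)^-1.

(** Kernel sqrt(1-e^{-phi(x)}) G(x,y) sqrt(1-e^{-phi(y)}). *)
Definition Kphi (phi : R * R -> R) (G : R * R -> R * R -> R[i]) (x y : R * R) : R[i] :=
  (Num.sqrt (1 - expR (- phi x)))%:C * G x y * (Num.sqrt (1 - expR (- phi y)))%:C.

End Defs.

Section Prob.
Local Open Scope ereal_scope.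
Context {R : realType} {d : measure_display} {T : measurableType d}.

(** A finite point process on T is described by a random number of points
    [N] and the positions [X k] (k < N) of the points.
    alpha-GPP on O = disk Rad with kernel G (Laplace functional definition). *)
Definition is_alpha_GPP (P : probability T R) (Rad a : R)
    (G : R * R -> R * R -> R[i]) (N : T -> nat) (X : nat -> T -> R * R) : Prop :=
  (forall w k, (k < N w)%N -> pnorm (X k w) <= Rad)%R /\
  forall phi : R * R -> R, measurable_fun setT phi -> (forall x, 0 <= phi x)%R ->
    \int[P]_w (expR (- \sum_(k < N w) phi (X k w)))%:E
    = (powR (fredholm_det Rad a (Kphi phi G)) (- a^-1))%:E.

(** Gamma function. *)
Definition Gammaf (a : R) : R :=
  Rintegral (@lebesgue_measure R) `]0%R, +oo[ (fun t => powR t (a - 1) * expR (- t))%R.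

(** Density of the Gamma distribution with shape [a] and scale [b]. *)
Definition gamma_pdf (a b : R) (x : R) : R :=
  if (0 < x)%R then (powR x (a - 1) * expR (- x / b) / (Gammaf a * powR b a))%R
  else 0%R.

(** [Y] is Gamma distributed with shape a and scale b. *)
Definition gamma_distributed (P : probability T R) (Y : T -> R) (a b : R) : Prop :=
  measurable_fun setT Y /\
  forall A : set R, measurable A ->
    P (Y @^-1` A) = \int[@lebesgue_measure R]_(x in A) (gamma_pdf a b x)%:E.

(** Mutual independence of a family of sub-sigma-algebras (product rule
    over every finite subfamily). *)
Definition mutually_independent {I : eqType} (P : probability T R)
    (F : I -> set (set T)) : Prop :=
  forall (J : seq I) (E : I -> set T), uniq J ->
    (forall i, i \in J -> F i (E i)) ->
    P (\bigcap_(i in [set` J]) E i) = \prod_(i <- J) P (E i).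

(** sigma-algebra generated by a random variable. *)
Definition sigma_of {d' : measure_display} {U : measurableType d'} (Y : T -> U)
  : set (set T) := [set Y @^-1` B | B in [set B : set U | measurable B]].

(** sigma-algebra generated by the point process (N, X_0, X_1, ...). *)
Definition sigma_pp (N : T -> nat) (X : nat -> T -> R * R) : set (set T) :=
  <<s setT, sigma_of N `|` \bigcup_k sigma_of (X k) >>.

(** Laplace transform relation: [f] is an inverse Laplace transform of [g],
    i.e. \int_0^oo e^{-s r} f(r) dr = g(s) for every s > 0. *)
Definition is_inverse_laplace (g : R -> R) (f : R -> R) : Prop :=
  forall s : R, (0 < s)%R ->
    \int[@lebesgue_measure R]_(r in `[0%R, +oo[) (expR (- s * r) * f r)%:E
    = (g s)%:E.

End Prob.

Section Model.
Context {R : realType} {d : measure_display} {T : measurableType d}.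
Local Open Scope complex_scope.

(** Incident power P_I = P_A sum_{a} h_{a,S} |x_a|^{-mu}, with the points
    x_a = X k w (k < N w) and fading h_{a,S} = h k w. *)
Definition incident_power (PA mu : R) (N : T -> nat) (X : nat -> T -> R * R)
    (h : nat -> T -> R) (w : T) : R :=
  PA * \sum_(k < N w) h k w * powR (pnorm (X k w)) (- mu).

(** CDF of a real random variable Y: F_Y(r) = P[Y <= r]. *)
Definition cdfR (P : probability T R) (Y : T -> R) (r : R) : R :=
  fine (P [set w | Y w <= r]).

(** Kernel A_Phi(s)(x,y) =
    sqrt(1-(1+s theta P_A/(m|x|^mu))^{-m}) G(x,y) sqrt(1-(1+s theta P_A/(m|y|^mu))^{-m}). *)
Definition A_Phi (s theta PA m mu : R) (G : R * R -> R * R -> R[i]) (x y : R * R) : R[i] :=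
  (Num.sqrt (1 - powR (1 + s * theta * PA / (m * powR (pnorm x) mu)) (- m)))%:C
  * G x y
  * (Num.sqrt (1 - powR (1 + s * theta * PA / (m * powR (pnorm y) mu)) (- m)))%:C.

(** Backscatter-mode probability of PTP: B_PTP = P[P_E^H <= rho_H],
    with P_E^H = omega beta P_I. *)
Definition B_PTP (P : probability T R) (PI : T -> R) (omg beta rhoH : R) : R :=
  fine (P [set w | omg * beta * PI w <= rhoH]).

(** Energy outage probability for a protocol with backscatter-mode probability Bm:
    O = Bm P[P_E^B <= rho_B] + (1 - Bm) P[P_E^H <= rho_H],
    P_E^B = beta varrho P_I,  P_E^H = omega beta P_I. *)
Definition energy_outage (P : probability T R) (PI : T -> R)
    (Bm beta varrho omg rhoB rhoH : R) : R :=
  Bm * fine (P [set w | beta * varrho * PI w <= rhoB])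
  + (1 - Bm) * fine (P [set w | omg * beta * PI w <= rhoH]).

End Model.

(* Main.v *)
Require Import Defs.
From HB Require Import structures.
From mathcomp Require Import all_boot all_order all_algebra.
From mathcomp Require Import all_classical all_reals all_analysis.
From mathcomp Require Import measurable_realfun.
From mathcomp Require Import complex ring.
Import Order.TTheory GRing.Theory Num.Theory.
Import numFieldNormedType.Exports.
Local Open Scope classical_set_scope.
Local Open Scope ring_scope.

(* Given the points, the fading marks are averaged out one at a time: on each
   event [N = n] the mark h_j is independent of the sigma-algebra generated by
   (N, X) and the other marks, so Tonelli replaces exp(- c_j h_j) by the Gamma
   Laplace transform (1 + (theta / m) c_j)^(-m).  What remains is the Laplace
   functional of the point process at
   phi(x) = m ln (1 + s theta P_A / (m |x|^mu)), for which K_phi = A_Phi.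
   For the CDF, Tonelli gives
   int_0^oo e^(-s r) P[P_I <= r] dr = E[int_(P_I)^oo e^(-s r) dr]
   = E[e^(-s P_I)] / s, as P_I >= 0 almost surely. *)

Set Implicit Arguments.
Unset Strict Implicit.
Unset Printing Implicit Defensive.

(** * Integration against a measure given by a density *)

Section density.
Local Open Scope ereal_scope.
Context {d : measure_display} {T : measurableType d} {R : realType}.
Variables (mu nu : {measure set T -> \bar R}) (g : T -> R).
Hypotheses (mg : measurable_fun setT g) (g0 : forall x, (0 <= g x)%R).
Hypothesis nuE : forall A, measurable A -> nu A = \int[mu]_(x in A) (g x)%:E.

Import HBNNSimple.

Lemma integral_density_nnsfun (f : {nnsfun T >-> R}) :
  \int[nu]_x (f x)%:E = \int[mu]_x (f x * g x)%:E.
Proof.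
rewrite integralT_nnsfun sintegralE.
under [RHS]eq_integral.
  move=> x _; rewrite fimfunE EFinM -fsumEFin// ge0_mule_fsuml; last first.
    by move=> r; rewrite EFinM nnfun_muleindic_ge0.
  over.
rewrite ge0_integral_fsum//; last 2 first.
- move=> r; apply/measurable_EFinP; apply: measurable_funM => //.
  exact: measurable_funM.
- by move=> r x _; rewrite mule_ge0 ?lee_fin// -lee_fin EFinM nnfun_muleindic_ge0.
apply: eq_fsbigr => r /[!inE] -[t _ <-].
rewrite nuE// integral_mkcond -ge0_integralZl//.
- apply: eq_integral => x _.
  rewrite patchE indicE; case: ifPn => _; first by rewrite mulr1.
  by rewrite mulr0 mul0e mule0.
- by apply/(measurable_restrictT _ _).1 => //; exact/measurable_funTS/measurable_EFinP.
- by move=> x _; rewrite patchE; case: ifPn; rewrite ?lee_fin.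
- by rewrite lee_fin.
Qed.

(** Increasing simple functions approximate [f]. Since [g] is nonnegative, their products with [g]
    still increase, so monotone convergence applies on both sides. *)
Lemma ge0_integral_density (f : T -> \bar R) :
  measurable_fun setT f -> (forall x, 0 <= f x) ->
  \int[nu]_x f x = \int[mu]_x (f x * (g x)%:E).
Proof.
move=> mf f0; pose f_ := nnsfun_approx measurableT mf.
transitivity (limn (fun n => \int[nu]_x (f_ n x)%:E)).
  rewrite -monotone_convergence//=.
  - by apply: eq_integral => x _; apply/esym/cvg_lim => //; exact: cvg_nnsfun_approx.
  - by move=> n; exact/measurable_EFinP.
  - by move=> n x _; rewrite lee_fin.
  - by move=> x _ a b ab; rewrite lee_fin; exact/lefP/nd_nnsfun_approx.
transitivity (limn (fun n => \int[mu]_x (f_ n x * g x)%:E)).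
  by apply: congr_lim; apply/funext => n; exact: integral_density_nnsfun.
rewrite -monotone_convergence//=.
- apply: eq_integral => x _; apply/cvg_lim => //.
  under eq_cvg do rewrite EFinM.
  by apply: cvgeZr => //; exact: cvg_nnsfun_approx.
- by move=> n; apply/measurable_EFinP/measurable_funM.
- by move=> n x _; rewrite lee_fin mulr_ge0.
- by move=> x _ a b ab; rewrite lee_fin ler_wpM2r//; exact/lefP/nd_nnsfun_approx.
Qed.

End density.

(** * Dilations of Lebesgue measure on the line *)

Section lebesgue_scaling.
Context {R : realType}.
Local Notation mu := (@lebesgue_measure R).
Variable c : {posnum R}.

Let scale (x : measurableTypeR R) : measurableTypeR R := x * c%:num.

Let measurable_scale : measurable_fun setT scale.
Proof. exact: measurable_funM. Qed.

Let scaled_mu : {measure set (measurableTypeR R) -> \bar R} :=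
  mscale c%:num%:nng
    (measure_function_pushforward__canonical__measure_function_Measure mu measurable_scale).

(** By uniqueness of Lebesgue measure it suffices to check intervals []a, b]]: the preimage has
    length [(b - a) / c], and the factor [c] restores [b - a]. *)
Lemma lebesgue_measureZ (A : set R) : measurable A ->
  mu A = (c%:num%:E * mu ((fun x => x * c%:num)%R @^-1` A))%E.
Proof.
move=> mA; rewrite -[RHS]/(scaled_mu A).
apply: lebesgue_measure_unique => //= _ [[a b]] _ <-.
rewrite /scaled_mu /mscale/= /pushforward.
rewrite (_ : _ @^-1` _ = `]a / c%:num, b / c%:num]%classic); last first.
  by apply/seteqP; split=> x /=; rewrite !in_itv/= ltr_pdivrMr// ler_pdivlMr.
rewrite !lebesgue_measure_itv/= !lte_fin ltr_pM2r//.
case: ifPn => _; last by rewrite mule0.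
by rewrite -!EFinD -EFinM -mulrBl mulrCA mulfV ?mulr1.
Qed.

Lemma ge0_integral_scale (f : R -> \bar R) :
  measurable_fun setT f -> (forall x, 0 <= f x)%E ->
  (\int[mu]_x f x = c%:num%:E * \int[mu]_x f (x * c%:num)%R)%E.
Proof.
move=> mf f0; rewrite (eq_measure_integral scaled_mu); last first.
  by move=> A mA _; exact: lebesgue_measureZ.
rewrite ge0_integral_mscale//=; congr (_ * _)%E.
exact: (ge0_integral_pushforward measurable_scale).
Qed.

End lebesgue_scaling.

(** * The Laplace transform of the Gamma law *)

Section gamma_laplace.
Context {R : realType}.
Local Notation mu := (@lebesgue_measure R).

Lemma gamma_pdf_ge0 (a b x : R) : 0 <= gamma_pdf a b x.
Proof.
rewrite /gamma_pdf; case: ifPn => // x0.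
rewrite divr_ge0 ?mulr_ge0 ?powR_ge0 ?expR_ge0//.
by apply: fine_ge0; apply: integral_ge0 => t _; rewrite lee_fin mulr_ge0 ?powR_ge0 ?expR_ge0.
Qed.

Lemma measurable_gamma_pdf (a b : R) : measurable_fun setT (gamma_pdf a b).
Proof.
apply: measurable_fun_ifT => //; first exact: measurable_fun_ltr.
apply: measurable_funM => //; apply: measurable_funM => //.
by apply: measurableT_comp => //; apply: measurable_funM.
Qed.

(* The substitution x -> x q with q = (1 + b c) / b turns the tilted density
   back into the integrand of the Gamma function. *)
Lemma expR_gamma_pdf (a b c x : R) (q := (1 + b * c) / b) :
  0 < a -> 0 < b -> 0 <= c ->
  expR (- (c * x)) * gamma_pdf a b x =
  powR (1 + b * c) (- a) * (q * (gamma_pdf a 1 (x * q))).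
Proof.
move=> a0 b0 c0.
have bc0 : 0 < 1 + b * c by rewrite ltr_pwDl// mulr_ge0// ltW.
have q0 : 0 < q by rewrite divr_gt0.
(* [q * q^(a-1) = q^a = (1 + b c)^a b^(-a)], so the prefactor cancels and leaves the normalisation
   [b^(-a)] of the density. *)
have E : powR (1 + b * c) (- a) * (q * powR q (a - 1)) = (powR b a)^-1.
  rewrite mulr_powRB1 ?(ltW q0)// /q powRM ?invr_ge0 ?(ltW bc0) ?(ltW b0)//.
  rewrite mulrA -powRD ?addNr ?eqxx ?gt_eqF// powRr0 mul1r.
  by rewrite -[b^-1]powR_inv1 ?(ltW b0)// -powRrM mulN1r powRN.
rewrite /gamma_pdf pmulr_lgt0//; case: ifPn => x0; last by rewrite !mulr0.
rewrite powR1 mulr1 divr1 (powRM _ (ltW x0) (ltW q0)).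
rewrite (_ : - (x * q) = - (c * x) + - x / b); last first.
  by rewrite /q; field; rewrite gt_eqF.
rewrite expRD.
rewrite [in RHS](_ : _ * _ = powR (1 + b * c) (- a) * (q * powR q (a - 1)) *
   (powR x (a - 1) * (expR (- (c * x)) * expR (- x / b))) / Gammaf a); last by ring.
rewrite E invfM; ring.
Qed.

(** The dilation by [q] absorbs the exponential tilt. The mass of [gamma_pdf a 1] is kept as a
    factor here and evaluated in [gamma_laplace]. *)
Lemma integral_expR_gamma_pdf (a b c : R) : 0 < a -> 0 < b -> 0 <= c ->
  (\int[mu]_x (expR (- (c * x)) * gamma_pdf a b x)%:E =
   (powR (1 + b * c) (- a))%:E * \int[mu]_x (gamma_pdf a 1 x)%:E)%E.
Proof.
move=> a0 b0 c0.
have bc0 : 0 < 1 + b * c by rewrite ltr_pwDl// mulr_ge0// ltW.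
have q0 : 0 < (1 + b * c) / b by rewrite divr_gt0.
have mpdf : measurable_fun setT (fun x : R => (gamma_pdf a 1 x)%:E).
  by apply/measurable_EFinP; exact: measurable_gamma_pdf.
rewrite (ge0_integral_scale (PosNum q0) mpdf)/=; last first.
  by move=> x; rewrite lee_fin gamma_pdf_ge0.
have mpdfq : measurable_fun setT (fun x : R => (gamma_pdf a 1 (x * ((1 + b * c) / b)))).
  apply: (measurableT_comp (measurable_gamma_pdf a 1)); exact: measurable_funM.
rewrite -ge0_integralZl ?lee_fin ?(ltW q0)//; last 2 first.
- exact/measurable_EFinP.
- by move=> x _; rewrite lee_fin gamma_pdf_ge0.
rewrite -ge0_integralZl ?lee_fin ?powR_ge0//; last 2 first.
- by apply/measurable_EFinP/measurable_funM.
- by move=> x _; rewrite mule_ge0 ?lee_fin ?gamma_pdf_ge0 ?(ltW q0).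
by apply: eq_integral => x _; rewrite expR_gamma_pdf// -!EFinM.
Qed.

(* The law has total mass 1, which spares a proof that [Gammaf a] is finite and
   nonzero. *)
Lemma gamma_laplace d (T : measurableType d) (P : probability T R) (Y : T -> R)
    (a b c : R) : 0 < a -> 0 < b -> 0 <= c -> gamma_distributed P Y a b ->
  (\int[P]_w (expR (- (c * Y w)))%:E = (powR (1 + b * c) (- a))%:E)%E.
Proof.
move=> a0 b0 c0 [mY YE].
(* At [c = 0] the tilted integral is the total mass of the law of [Y], and the factor [powR 1 (- a)]
   is 1. *)
have mass1 : (\int[mu]_x (gamma_pdf a 1 x)%:E = 1)%E.
  have := YE setT measurableT; rewrite preimage_setT probability_setT => ->.
  have := integral_expR_gamma_pdf a0 b0 (lexx _).
  rewrite mulr0 addr0 powR1 mul1e => <-.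
  by apply: eq_integral => x _; rewrite mul0r oppr0 expR0 mul1r.
have mY' : measurable_fun setT (Y : T -> measurableTypeR R) by exact: mY.
pose Y' : {mfun T >-> measurableTypeR R} :=
  HB.pack (Y : T -> measurableTypeR R) (isMeasurableFun.Build _ _ _ _ _ mY').
have mexp : measurable_fun setT (fun x : R => (expR (- (c * x)))%:E).
  apply/measurable_EFinP; apply: measurableT_comp => //.
  by apply: measurableT_comp => //; exact: measurable_funM.
have := @ge0_integral_distribution _ _ _ _ _ P Y' (fun x : R => (expR (- (c * x)))%:E).
move=> /(_ mexp) <-; last by move=> y; rewrite lee_fin expR_ge0.
rewrite (@ge0_integral_density _ _ R mu (distribution P Y') (gamma_pdf a b))//.
- by under eq_integral do rewrite -EFinM; rewrite integral_expR_gamma_pdf// mass1 mule1.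
- exact: measurable_gamma_pdf.
- by move=> x; exact: gamma_pdf_ge0.
Qed.

End gamma_laplace.

(** * Tonelli for two independent random variables *)

Section independent_pair.
Local Open Scope ereal_scope.
Context {d d1 d2 : measure_display} {T : measurableType d}
  {T1 : measurableType d1} {T2 : measurableType d2} {R : realType}.
Variables (P : probability T R) (Z : T -> T1) (V : T -> T2).
Hypotheses (mZ : measurable_fun setT Z) (mV : measurable_fun setT V).
Hypothesis indepZV : forall A B, measurable A -> measurable B ->
  P (Z @^-1` A `&` V @^-1` B) = P (Z @^-1` A) * P (V @^-1` B).

(** By independence the joint law agrees with the product of the marginal laws on rectangles, hence
    everywhere; Tonelli is then applied to the product. *)
Lemma independent_fubini_tonelli (f : T1 * T2 -> \bar R) :
  measurable_fun setT f -> (forall z, 0 <= f z) ->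
  \int[P]_w f (Z w, V w) = \int[P]_w \int[P]_w' f (Z w, V w').
Proof.
move=> mf f0.
pose Z' : {mfun T >-> T1} := HB.pack Z (isMeasurableFun.Build _ _ _ _ _ mZ).
pose V' : {mfun T >-> T2} := HB.pack V (isMeasurableFun.Build _ _ _ _ _ mV).
have mZV : measurable_fun setT (fun w => (Z w, V w)).
  exact: measurable_fun_pair.
pose ZV : {mfun T >-> (T1 * T2)%type} :=
  HB.pack (fun w => (Z w, V w)) (isMeasurableFun.Build _ _ _ _ _ mZV).
have prodE A : measurable A ->
    (distribution P Z' \x distribution P V') A = distribution P ZV A.
  by apply: product_measure_unique => B C mB mC; exact: indepZV.
have := @ge0_integral_distribution _ _ _ _ _ P ZV f mf f0 => /= <-.
rewrite -(@eq_measure_integral _ _ _ setT (distribution P ZV)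
  (distribution P Z' \x distribution P V')); last by move=> A mA _; exact: prodE.
rewrite fubini_tonelli1//.
rewrite ge0_integral_distribution; last 2 first.
- exact: measurable_fun_fubini_tonelli_F.
- by move=> x; apply: integral_ge0.
apply: eq_integral => w _; rewrite /comp /fubini_F ge0_integral_distribution//.
exact: measurableT_comp.
Qed.

End independent_pair.

(** * Independence of one member of a family from all the others jointly *)

Section independent_family.
Local Open Scope ereal_scope.
Context {d : measure_display} {T : measurableType d} {R : realType} {I : eqType}.
Variables (P : probability T R) (F : I -> set (set T)).
Hypothesis Fm : forall i, F i `<=` measurable.
Hypothesis FI : forall i, setI_closed (F i).
Hypothesis FT : forall i, F i setT.
Hypothesis indepF : mutually_independent P F.

(* The pi-system generating the sigma-algebra of all the [F i] with [i != j]. *)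
Definition finite_inter_except (j : I) : set (set T) :=
  [set A | exists J E, [/\ uniq J, j \notin J, forall i, F i (E i),
    forall i, i \notin J -> E i = setT & A = \bigcap_(i in [set` J]) E i]].

Lemma finite_inter_except1 j i A : i != j -> F i A -> finite_inter_except j A.
Proof.
move=> ij FA; exists [:: i], (fun k => if k == i then A else setT); split => //.
- by rewrite inE eq_sym.
- by move=> k; case: eqP => [->|].
- by move=> k; rewrite inE => /negbTE ->.
- by rewrite set_cons1 bigcap_set1 eqxx.
Qed.

Lemma finite_inter_exceptT j : finite_inter_except j setT.
Proof.
exists [::], (fun=> setT); split => //.
by rewrite set_nil bigcap_set0.
Qed.

Lemma finite_inter_except_measurable j : finite_inter_except j `<=` measurable.
Proof.
move=> _ [J [E [uJ jJ FE ET ->]]].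
by apply: fin_bigcap_measurable => // i _; exact: Fm.
Qed.

(** Because the events are [setT] off their index list, two families can be intersected index by
    index over the merged list. *)
Lemma finite_inter_except_setI j : setI_closed (finite_inter_except j).
Proof.
move=> _ _ [J1 [E1 [uJ1 jJ1 FE1 ET1 ->]]] [J2 [E2 [uJ2 jJ2 FE2 ET2 ->]]].
exists (undup (J1 ++ J2)), (fun i => E1 i `&` E2 i); split.
- exact: undup_uniq.
- by rewrite mem_undup mem_cat negb_or jJ1.
- by move=> i; exact: FI.
- move=> i; rewrite mem_undup mem_cat negb_or => /andP[i1 i2].
  by rewrite ET1// ET2// setTI.
apply/seteqP; split => [x [x1 x2] i _|x xE].
  split.
    by have [/x1//|/ET1 ->] := boolP (i \in J1).
  by have [/x2//|/ET2 ->] := boolP (i \in J2).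
by split => i /= iJ; have [] := xE i _ => //=; rewrite mem_undup mem_cat iJ ?orbT.
Qed.

(** The product rule is used twice: for [j :: J] with [B] as the event at [j], and for [J] alone to
    reassemble [P A]. *)
Lemma independent_finite_inter j A B : finite_inter_except j A -> F j B ->
  P (A `&` B) = P A * P B.
Proof.
move=> [J [E [uJ jJ FE ET ->]]] FB.
pose E' i := if i == j then B else E i.
have E'E i : i \in J -> E' i = E i.
  by rewrite /E'; case: eqP => // ->; rewrite (negbTE jJ).
have E'j : E' j = B by rewrite /E' eqxx.
have := @indepF (j :: J) E'; rewrite /= jJ uJ => /(_ isT).
rewrite big_cons E'j (eq_big_seq (fun i => P (E i))); last by move=> i /E'E ->.
rewrite -(@indepF J E)// muleC => <-; last first.
  by move=> i _; rewrite /E'; case: eqP => [->|].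
congr (P _); apply/seteqP; split => [x [xE xB] i /=|x xE].
  rewrite inE => /predU1P[->|iJ]; first by rewrite E'j.
  by rewrite E'E//; exact: xE.
split => [i /= iJ|].
  by rewrite -E'E//; apply: xE; rewrite /= inE iJ orbT.
by rewrite -E'j; apply: xE; rewrite /= inE eqxx.
Qed.

(** For fixed [B], both sides are finite measures in [A] that agree on a pi-system containing
    [setT], so they agree on the sigma-algebra it generates. *)
Lemma independent_generated j A B :
  <<s finite_inter_except j >> A -> F j B -> P (A `&` B) = P A * P B.
Proof.
move=> sA FB; have mB := Fm FB.
have PB0 : (0 <= fine (P B))%R by exact: fine_ge0.
rewrite muleC -[P B]fineK ?fin_num_measure// -[LHS]/(mrestr P mB A).
rewrite -[RHS]/(mscale (NngNum PB0) P A).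
apply: (g_sigma_algebra_measure_unique (finite_inter_except j) _ (fun=> setT)) => //.
- exact: finite_inter_except_measurable.
- by move=> _; exact: finite_inter_exceptT.
- by apply: bigcup_const; exists 0%N.
- exact: finite_inter_except_setI.
- move=> C PC; rewrite /= /mrestr /mscale/= fineK ?fin_num_measure// muleC.
  exact: (independent_finite_inter PC FB).
- move=> k; rewrite /= /mrestr setTI.
  by rewrite (le_lt_trans (probability_le1 _ _))// ltry.
Qed.

(** The identity map, with the generated sigma-algebra on its target, serves as the first variable
    of the pair. Thus [f] may depend on all members other than [j] at once. *)
Lemma independent_integral j d' (U : measurableType d') (V : T -> U)
    (f : g_sigma_algebraType (finite_inter_except j) * U -> \bar R) :
  measurable_fun setT V -> sigma_of V `<=` F j ->
  measurable_fun setT f -> (forall z, 0 <= f z) ->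
  \int[P]_w f (w, V w) = \int[P]_w \int[P]_w' f (w, V w').
Proof.
move=> mV VF mf f0.
pose Z (w : T) : g_sigma_algebraType (finite_inter_except j) := w.
have mZ : measurable_fun setT Z.
  move=> _ A sA; rewrite setTI preimage_id.
  move: A sA; apply: smallest_sub; first exact: sigma_algebra_measurable.
  exact: finite_inter_except_measurable.
have indepZV A B : measurable A -> measurable B ->
    P (Z @^-1` A `&` V @^-1` B) = P (Z @^-1` A) * P (V @^-1` B).
  move=> sA mB; rewrite preimage_id; apply: (independent_generated sA).
  by apply: VF; exists B.
exact: (independent_fubini_tonelli mZ mV indepZV).
Qed.

End independent_family.

Section except_measurable.
Context {d : measure_display} {T : measurableType d} {I : eqType}.
Variable F : I -> set (set T).
Hypothesis FT : forall i, F i setT.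

Lemma measurable_fun_except (j i : I) d' (U : measurableType d') (V : T -> U) :
  i != j -> sigma_of V `<=` F i ->
  measurable_fun setT (V : g_sigma_algebraType (finite_inter_except F j) -> U).
Proof.
move=> ij VF _ A mA; rewrite setTI; apply: sub_sigma_algebra.
by apply: (finite_inter_except1 FT ij); apply: VF; exists A.
Qed.

End except_measurable.

(** * Splitting along the values of a random integer *)

Section random_index.
Context {d : measure_display} {T : measurableType d}.
Variable N : T -> nat.
Hypothesis mN : measurable_fun setT N.

Let measurable_N n : measurable (N @^-1` [set n]).
Proof. by rewrite -[X in measurable X]setTI; exact: mN. Qed.

Let N_cover : \bigcup_n (N @^-1` [set n]) = setT.
Proof. by rewrite -subTset => w _; exists (N w). Qed.

Lemma measurable_fun_random_index d' (U : measurableType d') (G : nat -> T -> U) :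
  (forall n, measurable_fun setT (G n)) -> measurable_fun setT (fun w => G (N w) w).
Proof.
move=> mG; rewrite -N_cover; apply/measurable_fun_bigcup => // n.
apply: (eq_measurable_fun (G n)); last exact: measurable_funTS.
by move=> w; rewrite inE /= => ->.
Qed.

Lemma ge0_integral_random_index {R : realType} (mu : {measure set T -> \bar R})
    (G : nat -> T -> \bar R) :
  (forall n, measurable_fun setT (G n)) -> (forall n w, 0 <= G n w)%E ->
  (\int[mu]_w G (N w) w = \sum_(n <oo) \int[mu]_(w in N @^-1` [set n]) G n w)%E.
Proof.
move=> mG G0; rewrite -N_cover ge0_integral_bigcup//.
- apply: eq_eseriesr => n _; apply: eq_integral => w.
  by rewrite inE /= => ->.
- by rewrite N_cover; exact: measurable_fun_random_index.
- by move=> i j _ _ [w [/= <- <-]].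
Qed.

End random_index.

(** * Averaging out independent Gamma marks *)

Section independent_gamma_marks.
Context {d : measure_display} {T : measurableType d} {R : realType}.
Variables (P : probability T R) (h : nat -> T -> R) (a b : R).
Variable S : set (set T).
(** [None] carries [S], an abstract stand-in for the information on the points; each [Some k]
    carries one mark. *)
Let F (i : option nat) := if i is Some k then sigma_of (h k) else S.
Hypotheses (a0 : 0 < a) (b0 : 0 < b).
Hypothesis gammah : forall k, gamma_distributed P (h k) a b.
Hypothesis Sm : S `<=` measurable.
Hypothesis SI : setI_closed S.
Hypothesis ST : S setT.
Hypothesis indep : mutually_independent P F.

Let mh k : measurable_fun setT (h k). Proof. by have [] := gammah k. Qed.

Let Fm i : F i `<=` measurable.
Proof.
by case: i => //= k _ [B mB <-]; rewrite -[X in measurable X]setTI; exact: mh.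
Qed.

Let FI i : setI_closed (F i).
Proof.
case: i => //= k _ _ [A mA <-] [B mB <-]; exists (A `&` B) => //.
exact: measurableI.
Qed.

Let FT i : F i setT.
Proof. by case: i => //= k; exists setT => //=; exact: measurableT. Qed.

(** [Y] and [C] depend only on members other than [h j], so they can be frozen while [h j] is
    integrated by [gamma_laplace] with parameter [C w]. *)
Lemma integral_gamma_mark (j : nat) (Y C : T -> R)
    (T' := g_sigma_algebraType (finite_inter_except F (Some j))) :
  measurable_fun setT (Y : T' -> R) -> measurable_fun setT (C : T' -> R) ->
  (forall w, 0 <= Y w) -> (forall w, 0 <= C w) ->
  (\int[P]_w (Y w * expR (- (C w * h j w)))%:E =
   \int[P]_w (Y w * powR (1 + b * C w) (- a))%:E)%E.
Proof.
move=> mY mC Y0 C0.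
pose f (z : T' * R) := (Y z.1 * expR (- (C z.1 * z.2)))%:E.
have mf : measurable_fun setT f.
  apply/measurable_EFinP; apply: measurable_funM.
    exact: (measurableT_comp mY).
  apply: measurableT_comp => //; apply: measurableT_comp => //.
  by apply: measurable_funM => //; exact: (measurableT_comp mC).
have f0 z : (0 <= f z)%E by rewrite lee_fin mulr_ge0 ?expR_ge0.
have := independent_integral Fm FI FT indep (@mh j) _ mf f0.
rewrite /f /= => -> //; apply: eq_integral => w _.
under eq_integral do rewrite EFinM.
rewrite ge0_integralZl ?lee_fin//.
- by rewrite (gamma_laplace a0 b0 (C0 w) (gammah j)).
- apply/measurable_EFinP; apply: measurableT_comp => //.
  by apply: measurableT_comp => //; apply: measurable_funM.
Qed.

Variable c : nat -> T -> R.
Hypothesis c0 : forall k w, 0 <= c k w.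
Hypothesis cS : forall k, sigma_of (c k) `<=` S.

Let mark k w := expR (- (c k w * h k w)).
Let mean k w := powR (1 + b * c k w) (- a).

Let mean_of_c_measurable (r : R) : measurable_fun setT (fun x : R => powR (1 + b * x) r).
Proof.
apply: (measurableT_comp (measurable_powR r)).
by apply: measurable_funD => //; exact: measurable_funM.
Qed.

Lemma integral_prod_gamma_marks (D : set T) n : S D ->
  (\int[P]_(w in D) (\prod_(k < n) expR (- (c k w * h k w)))%:E =
   \int[P]_(w in D) (\prod_(k < n) powR (1 + b * c k w) (- a))%:E)%E.
Proof.
move=> SD.
(* In [mixed j] the first [j] marks are already averaged out. *)
pose mixed j k w := if (k < j)%N then mean k w else mark k w.
(* The restriction to [D] becomes an indicator factor, which can then be frozen together with the
   other factors. *)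
have E G : (\int[P]_(w in D) (\prod_(k < n) G k w)%:E =
    \int[P]_w (\1_D w * \prod_(k < n) G k w)%:E)%E.
  rewrite integral_mkcond; apply: eq_integral => w _.
  by rewrite patchE indicE; case: ifPn; rewrite ?mul1r ?mul0r.
suff H j : (j <= n)%N -> (\int[P]_w (\1_D w * \prod_(k < n) mark k w)%:E =
    \int[P]_w (\1_D w * \prod_(k < n) mixed j k w)%:E)%E.
  rewrite (E mark) (E mean) (H n)//; apply: eq_integral => w _.
  by congr (_ * _)%:E; apply: eq_bigr => k _; rewrite /mixed ltn_ord.
elim: j => [_|j IHj jn]; first by [].
rewrite IHj; last exact: ltnW.
(* [Y] gathers every factor that does not involve the mark [h j]; passing from [mixed j] to
   [mixed j.+1] changes only the remaining factor. *)
pose Y w := \1_D w * \prod_(k < n | k != j :> nat) mixed j k w.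
have YE G w : (forall k, k != j -> G k w = mixed j k w) ->
    \1_D w * \prod_(k < n) G k w = Y w * G j w.
  move=> GE; rewrite (bigD1 (Ordinal jn))//= mulrCA mulrC /Y; congr (_ * _ * _).
  by apply: eq_bigr => k kj; rewrite GE.
have -> : (\int[P]_w (\1_D w * \prod_(k < n) mixed j k w)%:E =
    \int[P]_w (Y w * expR (- (c j w * h j w)))%:E)%E.
  by apply: eq_integral => w _; rewrite YE// /mixed ltnn.
have -> : (\int[P]_w (\1_D w * \prod_(k < n) mixed j.+1 k w)%:E =
    \int[P]_w (Y w * powR (1 + b * c j w) (- a))%:E)%E.
  apply: eq_integral => w _; rewrite YE; first by rewrite /mixed ltnSn.
  by move=> k kj; rewrite /mixed ltnS leq_eqVlt (negbTE kj).
apply: integral_gamma_mark => //.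
- apply: measurable_funM.
    apply: measurable_indic; apply: sub_sigma_algebra.
    exact: (@finite_inter_except1 _ _ _ F FT (Some j) None).
  (* The omitted factor is replaced by 1, so that measurability can be checked factor by factor over
     all [k < n]. *)
  apply: (eq_measurable_fun
      (fun w : g_sigma_algebraType (finite_inter_except F (Some j)) =>
       \prod_(k < n) (if k != j :> nat then mixed j k w else 1))).
    by move=> w _; exact/esym/big_mkcond.
  apply: measurable_prod => k _; case: (eqVneq (k : nat) j) => //= kj.
  have mc := @measurable_fun_except _ _ _ F FT (Some j) None _ _ (c k) isT (@cS k).
  rewrite /mixed; case: (k < j)%N.
    exact: (measurableT_comp (mean_of_c_measurable (- a)) mc).
  have mhk := @measurable_fun_except _ _ _ F FT (Some j) (Some (k : nat)) _ _
    (h k) kj (@subset_refl _ _).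
  apply: (measurableT_comp (@measurable_expR R)).
  apply: (measurableT_comp (@oppr_measurable R setT)).
  exact: (measurable_funM mc mhk).
- exact: (@measurable_fun_except _ _ _ F FT (Some j) None _ _ (c j) isT (@cS j)).
- move=> w; rewrite mulr_ge0// prodr_ge0// => k _; rewrite /mixed.
  by case: ifPn; rewrite ?powR_ge0 ?expR_ge0.
Qed.

End independent_gamma_marks.

(** * Products of a random number of marks *)

Section random_product.
Context {d : measure_display} {T : measurableType d} {R : realType}.
Variables (P : probability T R) (h : nat -> T -> R) (a b : R).
Variable S : set (set T).
Hypotheses (a0 : 0 < a) (b0 : 0 < b).
Hypothesis gammah : forall k, gamma_distributed P (h k) a b.
Hypothesis Sm : S `<=` measurable.
Hypothesis SI : setI_closed S.
Hypothesis ST : S setT.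
Hypothesis indep : mutually_independent P
  (fun i : option nat => if i is Some k then sigma_of (h k) else S).
Variables (N : T -> nat) (c : nat -> T -> R).
Hypothesis NS : sigma_of N `<=` S.
Hypothesis c0 : forall k w, 0 <= c k w.
Hypothesis cS : forall k, sigma_of (c k) `<=` S.

Let mc k : measurable_fun setT (c k).
Proof. by move=> _ A mA; rewrite setTI; apply: Sm; apply: cS; exists A. Qed.

Let mN : measurable_fun setT N.
Proof. by move=> _ A mA; rewrite setTI; apply: Sm; apply: NS; exists A. Qed.

(** The events [N = n] partition the space and belong to [S], so each one is an admissible [D] for
    [integral_prod_gamma_marks]. *)
Lemma integral_random_prod_gamma_marks :
  (\int[P]_w (\prod_(k < N w) expR (- (c k w * h k w)))%:E =
   \int[P]_w (\prod_(k < N w) powR (1 + b * c k w) (- a))%:E)%E.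
Proof.
have mh k : measurable_fun setT (h k) by have [] := gammah k.
rewrite (ge0_integral_random_index mN P
  (G := fun n w => (\prod_(k < n) expR (- (c k w * h k w)))%:E)); last 2 first.
- move=> n; apply/measurable_EFinP; apply: measurable_prod => k _.
  by apply: measurableT_comp => //; apply: measurableT_comp => //; exact: measurable_funM.
- by move=> n w; rewrite lee_fin prodr_ge0// => k _; exact: expR_ge0.
rewrite (ge0_integral_random_index mN P
  (G := fun n w => (\prod_(k < n) powR (1 + b * c k w) (- a))%:E)); last 2 first.
- move=> n; apply/measurable_EFinP; apply: measurable_prod => k _.
  apply: (measurableT_comp (measurable_powR (- a))).
  by apply: measurable_funD => //; exact: measurable_funM.
- by move=> n w; rewrite lee_fin prodr_ge0// => k _; exact: powR_ge0.
apply: eq_eseriesr => n _.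
apply: (integral_prod_gamma_marks a0 b0 gammah Sm SI ST indep c0 cS).
by apply: NS; exists [set n].
Qed.

End random_product.

Section sublevel_sets.
Context {d : measure_display} {T : measurableType d} {R : realType}.
Variable Y : T -> R.
Hypothesis mY : measurable_fun setT Y.

Lemma measurable_sublevel r : measurable [set w | Y w <= r].
Proof.
rewrite -[X in measurable X]setTI.
have := mY measurableT (measurable_itv `]-oo, r]).
by congr (measurable _); apply/seteqP; split => w /=; rewrite in_itv.
Qed.

Lemma measurable_strict_sublevel r : measurable [set w | Y w < r].
Proof.
rewrite -[X in measurable X]setTI.
have := mY measurableT (measurable_itv `]-oo, r[).
by congr (measurable _); apply/seteqP; split => w /=; rewrite in_itv.
Qed.

End sublevel_sets.

(** * The Laplace transform of a distribution function *)

Section laplace_cdf.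
Context {R : realType}.
Local Notation mu := (@lebesgue_measure R).

Lemma integral_expR_tail (s y : R) : 0 < s ->
  (\int[mu]_(r in `[y, +oo[) (expR (- s * r))%:E = (s^-1 * expR (- s * y))%:E)%E.
Proof.
(* [G] is the antiderivative of the integrand that vanishes at infinity, so only its value at [y]
   contributes. *)
move=> s0; pose G (r : R) := - s^-1 * expR (- s * r).
have cexp : continuous (fun r : R => expR (- s * r)).
  move=> z; apply: continuous_comp; last exact: continuous_expR.
  by apply: continuousM => //; exact: cst_continuous.
have dG (z : R) : is_derive z 1 G (expR (- s * z)).
  rewrite /G; apply: is_derive_eq.
  by rewrite /GRing.scale/=; field; rewrite gt_eqF.
rewrite (@ge0_continuous_FTC2y _ _ G _ 0)//.
- by rewrite add0e /G -EFinN mulNr opprK.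
- by apply: continuous_subspaceT.
- rewrite -(mulr0 (- s^-1)); apply: cvgMr.
  rewrite (_ : (fun x => expR (- s * x)) =
               (fun z => expR (- z)) \o (fun z => s * z)); last first.
    by apply: eq_fun => x; rewrite mulNr.
  apply: (@cvg_comp _ _ _ _ _ _ (pinfty_nbhs R)); last exact: cvgr_expR.
  exact: gt0_cvgMry.
- by apply/cvg_at_right_filter; apply: cvgMr; exact: cexp.
- by move=> z _; rewrite derive1E; exact: derive_val.
Qed.

Lemma laplace_cdf d (T : measurableType d) (P : probability T R) (Y : T -> R) (s : R) :
  measurable_fun setT Y -> P [set w | Y w < 0] = 0%E -> 0 < s ->
  (\int[mu]_(r in `[0%R, +oo[) (expR (- s * r) * cdfR P Y r)%:E =
   (s^-1)%:E * \int[P]_w (expR (- s * Y w))%:E)%E.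
Proof.
move=> mY Y0 s0.
(* Integrating [g] over [w] first gives [exp (- s r)] times the distribution function on [r >= 0];
   integrating over [r] first gives an exponential tail. *)
pose g (z : measurableTypeR R * T) :=
  if (0 <= z.1) && (Y z.2 <= z.1) then expR (- s * z.1) else 0.
have mYle := measurable_sublevel mY.
have g0 z : (0 <= (g z)%:E)%E by rewrite lee_fin /g; case: ifPn; rewrite ?expR_ge0.
have mg : measurable_fun setT (fun z => (g z)%:E).
  apply/measurable_EFinP; apply: measurable_fun_ifT => //.
    apply: measurable_and; apply: measurable_fun_ler => //.
    exact: measurableT_comp.
  by apply: measurableT_comp => //; exact: measurable_funM.
have mexpY : measurable_fun setT (fun w => (expR (- s * Y w))%:E).
  by apply/measurable_EFinP; apply: measurableT_comp => //; exact: measurable_funM.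
transitivity (\int[mu]_r \int[P]_w (g (r, w))%:E)%E.
  rewrite integral_mkcond; apply: eq_integral => r _.
  rewrite patchE mem_setE in_itv/= andbT /g/=; case: ifPn => r0; last first.
    by rewrite integral0_eq.
  transitivity (\int[P]_w ((expR (- s * r))%:E * (\1_[set w | Y w <= r] w)%:E))%E.
    rewrite ge0_integralZl ?lee_fin ?expR_ge0//.
    - by rewrite integral_indic// setIT EFinM fineK// fin_num_measure.
    - exact/measurable_EFinP/measurable_indic.
  apply: eq_integral => w _; rewrite indicE; have [Yw|Yw] := boolP (Y w <= r).
    by rewrite mem_set// mule1.
  by rewrite memNset ?mule0//; exact/negP.
rewrite (fubini_tonelli (fun z => (g z)%:E))//.
rewrite -ge0_integralZl ?lee_fin ?invr_ge0 ?(ltW s0)//.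
apply: ge0_ae_eq_integral => //.
- exact: (measurable_fun_fubini_tonelli_G (fun z => (g z)%:E)).
- exact: measurable_funeM.
- by move=> w _; apply: integral_ge0.
- by move=> w _; rewrite mule_ge0// lee_fin ?expR_ge0 ?invr_ge0 ?(ltW s0).
(* Where [Y w < 0] the inner integral starts at 0 instead of [Y w], so the tail formula is applied
   only off this null set. *)
exists [set w | Y w < 0]; split => //.
  exact: measurable_strict_sublevel.
move=> w /= => Hw; rewrite ltNge; apply/negP => Yw0; apply: Hw => _.
rewrite -EFinM -integral_expR_tail// [RHS]integral_mkcond.
apply: eq_integral => r _; rewrite patchE mem_setE in_itv/= andbT /g/=.
have [Ywr|_] := boolP (Y w <= r); last by rewrite andbF.
by rewrite (le_trans Yw0 Ywr).
Qed.

End laplace_cdf.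
Section planar_measurability.
Context {R : realType}.

Lemma measurable_pnorm : measurable_fun setT (@pnorm R).
Proof.
have msqrt : measurable_fun setT (@Num.sqrt R).
  by apply: continuous_measurable_fun; exact: sqrt_continuous.
have msq : measurable_fun setT (fun p : R * R => p.1 ^+ 2 + p.2 ^+ 2).
  by apply: measurable_funD; exact: measurable_funX.
exact: (measurableT_comp msqrt msq).
Qed.

Lemma measurable_powR_pnorm (p : R) : measurable_fun setT (fun x : R * R => powR (pnorm x) p).
Proof. exact: (measurableT_comp (measurable_powR p) measurable_pnorm). Qed.

End planar_measurability.

(** * Sign and Laplace transform of the incident power *)

Section incident_power_theory.
Context {R : realType} {d : measure_display} {T : measurableType d}.
Variables (P : probability T R) (PA mu m b : R).
Variables (N : T -> nat) (X : nat -> T -> R * R) (h : nat -> T -> R).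
Hypotheses (mN : measurable_fun setT N) (mX : forall k, measurable_fun setT (X k)).
Hypothesis gammah : forall k, gamma_distributed P (h k) m b.

Let mh k : measurable_fun setT (h k). Proof. by have [] := gammah k. Qed.

Lemma measurable_incident_power : measurable_fun setT (incident_power PA mu N X h).
Proof.
apply: (measurable_fun_random_index mN
  (G := fun n w => PA * \sum_(k < n) h k w * powR (pnorm (X k w)) (- mu))) => n.
apply: measurable_funM => //; apply: measurable_sum => k.
by apply: measurable_funM => //; exact: (measurableT_comp (measurable_powR_pnorm _)).
Qed.

Lemma gamma_distributed_ge0 k : P [set w | h k w < 0] = 0%E.
Proof.
have [_ hE] := gammah k.
have := hE `]-oo, 0[%classic (measurable_itv _).
rewrite (_ : h k @^-1` _ = [set w | h k w < 0]); last first.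
  by apply/seteqP; split => w /=; rewrite in_itv.
move=> ->; apply: integral0_eq => x; rewrite /= in_itv/= => x0.
by rewrite /gamma_pdf ltNge (ltW x0).
Qed.

(** The marks are nonnegative only almost surely. A negative total forces some negative mark, and
    the union over [k] of these null events is null. *)
Lemma incident_power_ge0 : 0 <= PA ->
  P [set w | incident_power PA mu N X h w < 0] = 0%E.
Proof.
move=> PA0; apply: measure_negligible.
  exact/measurable_strict_sublevel/measurable_incident_power.
apply: (@negligibleS _ _ _ _ (\bigcup_k [set w | h k w < 0])); last first.
  apply: negligible_bigcup => k; exists [set w | h k w < 0]; split => //.
    exact: measurable_strict_sublevel.
  exact: gamma_distributed_ge0.
move=> w /=; apply: contraPP => hw; apply/negP; rewrite -leNgt.
rewrite mulr_ge0// sumr_ge0// => k _; rewrite mulr_ge0 ?powR_ge0// leNgt.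
by apply/negP => hk; apply: hw; exists k.
Qed.

Hypotheses (m0 : 0 < m) (b0 : 0 < b).
Hypothesis indep : mutually_independent P (fun i : option nat =>
  match i with None => sigma_pp N X | Some k => sigma_of (h k) end).

Let S := sigma_pp N X.
(** The space [T] with the sigma-algebra of the points; closure properties of [S] become
    measurability facts on [ST]. *)
Let ST := g_sigma_algebraType (sigma_of N `|` \bigcup_k sigma_of (X k)).

Let Sm : S `<=` measurable.
Proof.
apply: smallest_sub; first exact: sigma_algebra_measurable.
move=> _ [[B mB <-]|[k _ [B mB <-]]]; rewrite -[X in measurable X]setTI.
  exact: mN.
exact: mX.
Qed.

Let sX k : sigma_of (X k) `<=` S.
Proof. by move=> A sA; apply: sub_sigma_algebra; right; exists k. Qed.

(** The exponential of the sum factors into terms [exp (- c_k h_k)], with coefficients [c_k] that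
    are functions of the points alone. *)
Lemma laplace_incident_power s : 0 <= PA -> 0 <= s ->
  (\int[P]_w (expR (- s * incident_power PA mu N X h w))%:E =
   \int[P]_w (\prod_(k < N w)
     powR (1 + b * (s * PA * powR (pnorm (X k w)) (- mu))) (- m))%:E)%E.
Proof.
move=> PA0 s0; pose c k w := s * PA * powR (pnorm (X k w)) (- mu).
rewrite -(@integral_random_prod_gamma_marks _ _ _ P h m b S m0 b0 gammah Sm _ _ indep N c).
- apply: eq_integral => w _; congr EFin.
  rewrite /incident_power mulrA mulr_sumr expR_sum; apply: eq_bigr => k _.
  by congr expR; rewrite /c; ring.
- by move=> A B sA sB; exact: (@measurableI _ ST).
- exact: (@measurableT _ ST).
- by move=> A sA; apply: sub_sigma_algebra; left.
- by move=> k w; rewrite /c !mulr_ge0// powR_ge0.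
- move=> k _ [B mB <-]; apply: (@sX k).
  pose q (x : R * R) := s * PA * powR (pnorm x) (- mu).
  have mq : measurable_fun setT q.
    by apply: measurable_funM => //; exact: measurable_powR_pnorm.
  exists (q @^-1` B); last by [].
  by rewrite /= -[X in measurable X]setTI; exact: mq.
Qed.

End incident_power_theory.

(** [Kphi] depends on [phi] only through [exp (- phi)]. *)
Lemma Kphi_A_Phi {R : realType} (s theta PA m mu : R) (phi : R * R -> R)
    (G : R * R -> R * R -> R[i]) :
  (forall x, expR (- phi x) =
     powR (1 + s * theta * PA / (m * powR (pnorm x) mu)) (- m)) ->
  Kphi phi G = A_Phi s theta PA m mu G.
Proof.
by move=> phiE; apply/funext => x; apply/funext => y; rewrite /Kphi !phiE.
Qed.

Theorem theorem1 (R : realType) (d : measure_display) (T : measurableType d)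
  (P : probability T R)
  (mu Rad zetaA lA PA m theta beta varrho omg rhoB rhoH : R) (kappa : nat)
  (N : T -> nat) (X : nat -> T -> R * R) (h : nat -> T -> R) :
  2 < mu -> 0 < Rad -> (0 < kappa)%N -> 0 < zetaA -> 0 < lA <= 1 ->
  0 < PA -> 0 < m -> 0 < theta -> 0 < beta <= 1 -> 0 < varrho < 1 ->
  0 < omg < 1 -> 0 < rhoB -> 0 < rhoH ->
  measurable_fun setT N -> (forall k, measurable_fun setT (X k)) ->
  is_alpha_GPP P Rad (alpha R kappa) (ginibre (lA * zetaA)) N X ->
  (forall k, gamma_distributed P (h k) m (theta / m)) ->
  mutually_independent P (fun i : option nat =>
    match i with None => sigma_pp N X | Some k => sigma_of (h k) end) ->
  let PI := incident_power PA mu N X h in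
  let F := cdfR P PI in
  let LPI := fun s => powR (fredholm_det Rad (alpha R kappa)
                        (A_Phi s theta PA m mu (ginibre (lA * zetaA))))
                        (- (alpha R kappa)^-1) in
  (forall s, 0 < s -> (\int[P]_w (expR (- s * PI w))%:E)%E = (LPI s)%:E)
  /\ is_inverse_laplace (fun s => LPI s / s) F
  /\ energy_outage P PI (B_PTP P PI omg beta rhoH) beta varrho omg rhoB rhoH
     = F (rhoH / (omg * beta)) * (F (rhoB / (beta * varrho)) - F (rhoH / (omg * beta)) + 1).
Proof.
move=> mu2 Rad0 kappa0 zetaA0 lA01 PA0 m0 theta0 /andP[beta0 _] /andP[varrho0 _]
  /andP[omg0 _] rhoB0 rhoH0 mN mX [_ GPP] gammah indep PI F LPI.
have b0 : 0 < theta / m by rewrite divr_gt0.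
have laplaceE s : 0 < s -> (\int[P]_w (expR (- s * PI w))%:E)%E = (LPI s)%:E.
  move=> s0; rewrite (laplace_incident_power _ mN mX gammah m0 b0 indep) ?ltW//.
  pose q (x : R * R) := s * theta * PA / (m * powR (pnorm x) mu).
  pose phi x := m * ln (1 + q x).
  (* At the origin both sides are 0, since [powR 0 (- mu) = 0] and [0^-1 = 0]. *)
  have qE x : theta / m * (s * PA * powR (pnorm x) (- mu)) = q x.
    by rewrite /q (powRN _ mu) invfM; ring.
  have q0 x : 0 <= q x by rewrite divr_ge0 ?mulr_ge0 ?powR_ge0// ltW.
  have phiE x : expR (- phi x) = powR (1 + q x) (- m).
    by rewrite /powR gt_eqF ?ltr_pwDl// /phi mulNr.
  have mphi : measurable_fun setT phi.
    apply: measurable_funM => //; apply: (measurableT_comp (@measurable_ln R)).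
    apply: measurable_funD => //; rewrite /q.
    (* The division by [powR (pnorm x) mu] turns into a factor with exponent [- mu], whose
       measurability is known. *)
    under eq_fun do rewrite invfM -powRN mulrA.
    by apply: measurable_funM => //; exact: measurable_powR_pnorm.
  have phi0 x : 0 <= phi x.
    by rewrite mulr_ge0 ?ln_ge0 ?lerDl// ltW.
  transitivity (\int[P]_w (expR (- \sum_(k < N w) phi (X k w)))%:E)%E.
    apply: eq_integral => w _; congr EFin.
    rewrite -sumrN expR_sum; apply: eq_bigr => k _.
    by rewrite qE phiE.
  rewrite /LPI -(Kphi_A_Phi _ phiE); exact: (GPP phi mphi phi0).
split=> //; split=> [s s0|].
  rewrite /F laplace_cdf//.
  - by rewrite laplaceE// -EFinM mulrC.
  - exact: (measurable_incident_power PA mu mN mX gammah).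
  - exact: (incident_power_ge0 mu mN mX gammah (ltW PA0)).
(* Every outage event is a sublevel set of [PI]. With [x] and [y] the values of [F] at the HTT and
   backscatter thresholds, what remains is [x y + (1 - x) x = x (y - x + 1)]. *)
have scaleE (r rho : R) : 0 < r ->
    [set w | r * PI w <= rho] = [set w | PI w <= rho / r].
  by move=> r0; apply/seteqP; split => w /=; rewrite ler_pdivlMr// mulrC.
rewrite /energy_outage /B_PTP !scaleE ?mulr_gt0// -/(cdfR P PI _) -/(cdfR P PI _) -/F.
by ring.
Qed.
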